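(* Let $a\le r$ be positive integers and let $\epsilon\in(0,0.5)$. Then there are infinitely many $n\ge r^{\Omega(r/\epsilon)}$ (each a multiple of $r$) such that, for any positive integer $h$ with $hr\ge\Omega(n^{1-\epsilon})$ (and $\frac nr a+h<n$), there is an MR $(n,r,h,a)$-LRC over a field of size at most $n^{\epsilon h}$.
   Context: Definition: let $\ell$ be a prime power, $a,g,r,h$ positive integers with $ga+h<gr$, $n=gr$, $k=n-ga-h$. An MR (maximally recoverable) $(n,r,h,a)_\ell$-LRC is an $[n,k]$ linear code over $\mathbb{F}_\ell$ with a parity-check matrix $H$ of the block form whose first $ga$ rows are block diagonal with diagonal blocks $A_1,\dots,A_g$ (each $a\times r$, coordinates split into $g$ consecutive groups of size $r$) and whose last $h$ rows are $(D_1|\cdots|D_g)$ with each $D_i$ of size $h\times r$, such that (i) each $A_i$ generates an $[r,a,r-a+1]_\ell$ MDS code, and (ii) every set of $ag+h$ columns of $H$ consisting of any $a$ columns from each group together with any $h$ further columns is linearly independent over $\mathbb{F}_\ell$. ''Over a field of size $\ell$'' means an MR $(n,r,h,a)_\ell$-LRC. $\Omega(\cdot)$ is the usual asymptotic notation (lower bound up to an absolute positive constant). *)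

(* Defs.v *)
From HB Require Import structures.
From Stdlib Require Import Reals.
From mathcomp Require Import all_boot all_order all_algebra all_field.

Set Implicit Arguments.
Unset Strict Implicit.
Unset Printing Implicit Defensive.

Import GRing.Theory.
Local Open Scope ring_scope.

Definition wt (F : fieldType) (r : nat) (x : 'rV[F]_r) : nat :=
  #|[set j : 'I_r | x 0 j != 0]|.

Definition generates_MDS (F : fieldType) (a r : nat) (A : 'M[F]_(a, r)) : Prop :=
  [/\ \rank A = a,
      (forall x : 'rV[F]_r, (x <= A)%MS -> x != 0 -> ((r - a + 1)%N <= wt x)%N)
    & (exists x : 'rV[F]_r, [/\ (x <= A)%MS, x != 0 & wt x = (r - a + 1)%N])].

(* Coordinates (columns) are indexed by pairs (group i, position within group);
   rows are indexed by the g*a local rows (group i, local row k) followed by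
   the h global rows. *)
Definition pcm (F : fieldType) (g r a h : nat)
    (A : 'I_g -> 'M[F]_(a, r)) (D : 'I_g -> 'M[F]_(h, r))
    (row : ('I_g * 'I_a) + 'I_h) (col : 'I_g * 'I_r) : F :=
  match row with
  | inl (i, k) => if i == col.1 then A i k col.2 else 0
  | inr m => D col.1 m col.2
  end.

Definition cols_indep (F : fieldType) (g r a h : nat)
    (H : ('I_g * 'I_a) + 'I_h -> 'I_g * 'I_r -> F) (S : {set 'I_g * 'I_r}) : Prop :=
  forall v : 'I_g * 'I_r -> F,
    (forall c, c \notin S -> v c = 0) ->
    (forall row, \sum_(c : 'I_g * 'I_r) H row c * v c = 0) ->
    forall c, v c = 0.

(* The rows of H are linearly independent, i.e. the code ker H has dimension
   n - (g*a + h). *)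
Definition rows_indep (F : fieldType) (g r a h : nat)
    (H : ('I_g * 'I_a) + 'I_h -> 'I_g * 'I_r -> F) : Prop :=
  forall u : ('I_g * 'I_a) + 'I_h -> F,
    (forall c, \sum_row u row * H row c = 0) -> forall row, u row = 0.

Definition is_MR_LRC (F : fieldType) (g r h a : nat)
    (A : 'I_g -> 'M[F]_(a, r)) (D : 'I_g -> 'M[F]_(h, r)) : Prop :=
  [/\ forall i, generates_MDS (A i),
      rows_indep (pcm A D)
    & forall S : {set 'I_g * 'I_r},
        #|S| = (g * a + h)%N ->
        (forall i : 'I_g, (a <= #|[set c in S | c.1 == i]|)%N) ->
        cols_indep (pcm A D) S].

Definition exists_MR_LRC (n r h a : nat) (bound : R) : Prop :=
  exists F : finFieldType,
    Rle (INR #|F|) bound /\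
    exists (A : 'I_(n %/ r) -> 'M[F]_(a, r)) (D : 'I_(n %/ r) -> 'M[F]_(h, r)),
      is_MR_LRC A D.

(* Main.v *)
Require Import Defs.
From HB Require Import structures.
From Stdlib Require Import Reals Lra.
From mathcomp Require Import all_boot all_order all_algebra all_field cyclic.
From mathcomp Require Import zify.

(* Since [n] may be taken as large as we please in terms of [r] and [eps], the
   hypothesis [h r >= n^(1 - eps) >= sqrt n] forces [eps h >= r], and it suffices to
   find codes over a field of size at most [n^r], whatever [h] is.

   Take [n = r (p - 1)] with [p] a large prime, and the field [K] with [p^r] elements.
   All local matrices are the same Vandermonde matrix over [F_p]; row [m] of [D_i] is
   [Phi_i^m (b_j)], where [b] is an [F_p]-basis of [K], [Phi_i y = gam_i y^p], and
   [gam_1, ..., gam_g] are pairwise non-conjugate, i.e. have distinct norms in [F_p]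
   (linearized Reed-Solomon codes, as in the skew polynomial construction of
   Gopi and Guruswami).

   Let [S] be an erasure pattern with [S_i] its part in group [i], and suppose a
   combination of the rows of the parity-check matrix vanishes on [S]. The coefficients
   of the global rows form a skew polynomial [f] of degree less than [h], and
   [f(Phi_i)] vanishes on the combinations of the [b_j], [j] in [S_i], whose
   coefficients are killed by the local parity checks: a space of dimension at least
   [#|S_i| - a]. These dimensions add up to at least [h], whereas for nonzero [f] the
   kernels of the [f(Phi_i)] have total dimension at most [deg f]. So [f = 0], and the
   local coefficients vanish because every local code is MDS. *)

Set Implicit Arguments.
Unset Strict Implicit.
Unset Printing Implicit Defensive.

Import GRing.Theory.

(** * Skew polynomials as operators on [L], and the total dimension of their kernels *)

Section SkewPolynomials.
Local Open Scope ring_scope.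

Variables (F : fieldType) (L : fieldExtType F) (sigma : {lrmorphism L -> L}).

(** The skew polynomial with coefficients [f k], [k < N], where X c = sigma(c) X, with X acting as
    [y => a * sigma y]. *)
Definition skew_eval (N : nat) (f : nat -> L) (a x : L) : L :=
  \sum_(k < N) f k * iter k (fun y => a * sigma y) x.

Lemma iter_skew_linear (a : L) (k : nat) : linear (iter k (fun y : L => a * sigma y)).
Proof.
elim: k => // k IHk c x y.
by rewrite /= IHk linearP mulrDr -scalerAr.
Qed.

Lemma iter_skewM (a : L) (k : nat) (c x : L) :
  iter k (fun y => a * sigma y) (c * x) =
  iter k sigma c * iter k (fun y => a * sigma y) x.
Proof. by elim: k => //= k ->; rewrite rmorphM mulrCA. Qed.

Lemma skew_eval_linear (N : nat) (f : nat -> L) (a : L) : linear (skew_eval N f a).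
Proof.
move=> c x y; rewrite /skew_eval scaler_sumr -big_split; apply: eq_bigr => k _ /=.
by rewrite iter_skew_linear mulrDr -scalerAr.
Qed.

HB.instance Definition _ N f a :=
  GRing.isLinear.Build F L L _ (skew_eval N f a) (@skew_eval_linear N f a).

(* Right Euclidean division of [f] by [X - c] in the ring of skew polynomials, with
   quotient [g] and remainder [e]. *)
Lemma skew_div (N : nat) (f : nat -> L) (c : L) :
  exists (g : nat -> L) (e : L),
    (forall a x, skew_eval N.+1 f a x = skew_eval N g a (a * sigma x - c * x) + e * x) /\
    ((forall k, (k < N)%N -> g k = 0) ->
      forall k, (k <= N)%N -> f k = if k == 0%N then e else 0).
Proof.
elim: N f => [|N IHN] f.
  exists (fun _ => 0), (f 0%N); split=> [a x|_ [|k]] //.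
  by rewrite /skew_eval big_ord_recr !big_ord0 /= add0r.
(* Subtracting f_{N+1} X^N (X - c) cancels the leading term. As X^N c = sigma^N(c) X^N, this adds
   f_{N+1} sigma^N(c) to the coefficient of X^N. *)
have [g [e [fE f0]]] :=
  IHN (fun k => f k + if k == N then f N.+1 * iter N sigma c else 0).
exists (fun k => if k == N then f N.+1 else g k), e; split=> [a x | g0 k].
  have -> : skew_eval N.+2 f a x =
      skew_eval N.+1 (fun k => f k + if k == N then f N.+1 * iter N sigma c else 0) a x
      + f N.+1 * iter N (fun y => a * sigma y) (a * sigma x - c * x).
    rewrite /skew_eval [LHS]big_ord_recr !(big_ord_recr N) /= eqxx.
    under [in RHS]eq_bigr => i _ do rewrite (ltn_eqF (ltn_ord i)) addr0.
    rewrite -!addrA; congr (_ + _); rewrite mulrDl -addrA; congr (_ + _).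
    rewrite -[_ - c * x]addrC -[- (c * x)]scaleN1r iter_skew_linear scaleN1r.
    by rewrite -iterSr iter_skewM mulrDr mulrN (mulrA _ (iter N sigma c)) addrA subrr add0r.
  rewrite fE addrAC; congr (_ + _).
  rewrite /skew_eval [RHS]big_ord_recr /= eqxx; congr (_ + _).
  by apply: eq_bigr => i _; rewrite (ltn_eqF (ltn_ord i)).
have fN0 : f N.+1 = 0 by have := g0 N (leqnn _); rewrite eqxx.
rewrite leq_eqVlt => /orP[/eqP-> // | kN].
have /f0 : forall k, (k < N)%N -> g k = 0.
  by move=> j jN; have := g0 j (ltnW jN); rewrite (ltn_eqF jN).
by move=> /(_ k kN); rewrite fN0 mul0r if_same addr0.
Qed.

Hypothesis sigma_fix : forall x, sigma x = x -> x \in 1%VS.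

(** Induction on the degree: a nonzero [b] in the kernel at [i0] is killed by X - c for a suitable
    [c], so f = g (X - c). Applying X - c maps the kernels of [f] into those of [g], losing at most
    one dimension at [i0] and none elsewhere. *)
Lemma skew_eval_dim_ker (I : finType) (a : I -> L) :
    (forall i, a i != 0) ->
    (forall i j b, b != 0 -> a i * sigma b = a j * b -> i = j) ->
  forall (N : nat) (f : nat -> L) (k : nat), (k < N)%N -> f k != 0 ->
  (\sum_i \dim (lker (linfun (skew_eval N f (a i)))) < N)%N.
Proof.
move=> a_neq0 a_conj; elim=> // N IHN f k ltkN fk.
have [/forallP ker0|] :=
  boolP [forall i, lker (linfun (skew_eval N.+1 f (a i))) == 0%VS].
  by rewrite big1 // => i _; rewrite (eqP (ker0 i)) dimv0.
rewrite negb_forall => /existsP[i0 ker_neq0].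
set b := vpick (lker (linfun (skew_eval N.+1 f (a i0)))).
have b_neq0 : b != 0 by rewrite vpick0.
pose c := a i0 * sigma b / b.
have [g [e [fE f0]]] := skew_div N f c.
have cb : a i0 * sigma b - c * b = 0 by rewrite /c divfK // subrr.
have e0 : e = 0.
  have := memv_pick (lker (linfun (skew_eval N.+1 f (a i0)))).
  rewrite memv_ker lfunE /= -/b fE cb linear0 add0r mulf_eq0 (negPf b_neq0) orbF.
  by move/eqP.
have [j ltjN gj] : exists2 j, (j < N)%N & g j != 0.
  have [/existsP[j gj]|] := boolP [exists j : 'I_N, g j != 0]; first by exists j.
  rewrite negb_exists => /forallP g0; case/negP: fk; rewrite f0 // ?e0 ?if_same //.
  by move=> j ltjN; have := g0 (Ordinal ltjN); rewrite negbK => /eqP.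
rewrite ltnS; apply: leq_trans _ (IHN g j ltjN gj).
rewrite -[leqRHS]add1n.
have -> : 1%N = (\sum_i (i == i0))%N.
  by rewrite (bigD1 i0) //= eqxx big1 ?addn0 // => i /negPf->.
rewrite -big_split; apply: leq_sum => i _ /=.
have psi_lin : linear (fun x => a i * sigma x - c * x).
  move=> d x y; rewrite linearP !mulrDr -!scalerAr scalerBr opprD.
  by rewrite addrACA.
pose psi : {linear L -> L} := HB.pack (fun x => a i * sigma x - c * x)
  (GRing.isLinear.Build F L L _ _ psi_lin).
(* For [i = i0] this makes [x / b] a fixed point of [sigma]; for other [i] a nonzero [x] would
   contradict [a_conj]. *)
have psi0 x : a i * sigma x - c * x = 0 -> a i * sigma (x / b) = a i0 * (x / b).
  have sb_neq0 : sigma b != 0 by rewrite fmorph_eq0.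
  move/eqP; rewrite subr_eq0 fmorph_div mulrA => /eqP->.
  by rewrite /c -!mulrA; congr (_ * _); rewrite mulrCA (mulrCA (sigma b)) divff // mulr1 mulrC.
rewrite -(limg_ker_dim (linfun psi)); apply: leq_add.
  have [i_eq|neq_i] := eqVneq i i0.
    suff: (lker (linfun (skew_eval N.+1 f (a i))) :&: lker (linfun psi) <= <[b]>)%VS.
      by move/dimvS; rewrite dim_vline b_neq0.
    apply/subvP => x; rewrite memv_cap !memv_ker !lfunE /=.
    case/andP=> _ /eqP/psi0 sx; have /sigma_fix/vlineP[d xE] : sigma (x / b) = x / b.
      by apply: (mulfI (a_neq0 i0)); rewrite -sx i_eq.
    by apply/vlineP; exists d; rewrite -[LHS](divfK b_neq0) xE -scalerAl mul1r.
  rewrite leqn0 dimv_eq0 -subv0; apply/subvP => x; rewrite memv0 memv_cap !memv_ker !lfunE /=.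
  case/andP=> _ /eqP/psi0 sx; apply: contraR neq_i => x_neq0; apply/eqP.
  by apply: a_conj sx; rewrite mulf_neq0 ?invr_eq0.
apply: dimvS; apply/subvP => _ /memv_imgP[x + ->].
by rewrite !memv_ker !lfunE /= fE e0 mul0r addr0.
Qed.
End SkewPolynomials.

(** * Reed-Solomon codes: Vandermonde matrices are MDS *)

Section Vandermonde.
Local Open Scope ring_scope.

Variables (K : fieldType) (r a : nat) (pts : 'I_r -> K).
Hypothesis pts_inj : injective pts.

Definition vandermonde : 'M[K]_(a, r) := \matrix_(k, j) pts j ^+ k.

Lemma mul_vandermonde (u : 'rV[K]_a) j : (u *m vandermonde) 0 j = (rVpoly u).[pts j].
Proof.
rewrite mxE horner_poly; apply: eq_bigr => k _.
by rewrite mxE insubT //= => ltka; congr (u _ _ * _); apply: val_inj.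
Qed.

Lemma vandermonde_zeros (u : 'rV[K]_a) :
  u != 0 -> (#|[set j | (u *m vandermonde) 0%R j == 0%R]| < a)%N.
Proof.
move=> u_neq0; have p_neq0 : rVpoly u != 0.
  by apply: contra u_neq0 => /eqP up0; rewrite -[u]rVpolyK up0 linear0.
apply: leq_trans (size_poly _ _ : size (rVpoly u) <= a)%N.
set Z := [set j | _]; rewrite cardE -(size_map pts).
apply: max_poly_roots => //; last by rewrite (map_inj_uniq pts_inj) enum_uniq.
apply/allP => _ /mapP[j + ->]; rewrite mem_enum inE mul_vandermonde.
by rewrite /root.
Qed.

Lemma wt_zeros (x : 'rV[K]_r) : wt x = (r - #|[set j | x 0%R j == 0%R]|)%N.
Proof.
have <- : #|~: [set j | x 0 j == 0]| = wt x.
  by apply: eq_card => j; rewrite !inE.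
by rewrite cardsCs setCK card_ord.
Qed.

Lemma vandermonde_MDS : (0 < a)%N -> (a <= r)%N -> generates_MDS vandermonde.
Proof.
move=> a_gt0 lear.
have lt_zeros (u : 'rV_a) : u *m vandermonde != 0 ->
    (#|[set j | (u *m vandermonde) 0%R j == 0%R]| < a)%N.
  move=> uV; apply: vandermonde_zeros; apply: contraNneq uV => ->.
  by rewrite mul0mx.
split=> [|x /submxP[u ->] /lt_zeros ltz|].
- apply/eqP/inj_row_free => u uV0; apply/eqP; apply: contraT => /vandermonde_zeros.
  rewrite uV0 ltnNge -[X in (a <= X)%N](_ : r = _) ?lear //.
  by rewrite -[LHS]card_ord -cardsT; apply: eq_card => j; rewrite !inE mxE eqxx.
- by rewrite wt_zeros; move: ltz; set z := #|pred_of_set _|; lia.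
(* A word of minimum weight comes from the polynomial vanishing exactly at the first a - 1 points;
   its degree is less than r, so the word is nonzero. *)
pose t := take a.-1 (enum 'I_r).
have sz_t : size t = a.-1 by rewrite size_takel // size_enum_ord; lia.
pose P : {poly K} := \prod_(z <- map pts t) ('X - z%:P).
have szP : size P = a by rewrite size_prod_XsubC size_map sz_t prednK.
have Pj j : (poly_rV P *m vandermonde) 0 j = P.[pts j].
  by rewrite mul_vandermonde poly_rV_K ?szP.
have x_neq0 : poly_rV P *m vandermonde != 0.
  apply/eqP => PV0; have : (size (map pts (enum 'I_r)) < size P)%N.
    apply: max_poly_roots; rewrite -?size_poly_gt0 ?szP ?(map_inj_uniq pts_inj) ?enum_uniq //.
    by apply/allP => _ /mapP[j _ ->]; rewrite /root -Pj PV0 mxE.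
  by rewrite szP size_map size_enum_ord ltnNge lear.
exists (poly_rV P *m vandermonde); split=> //; first exact: submxMl.
rewrite wt_zeros; have := lt_zeros _ x_neq0; set Z := [set j | _].
suff : (a.-1 <= #|Z|)%N by lia.
rewrite -sz_t -(card_uniqP (take_uniq _ (enum_uniq 'I_r))); apply: subset_leq_card.
apply/subsetP => j tj; rewrite inE Pj -[_ == 0]/(root P _) root_prod_XsubC.
exact: map_f.
Qed.
End Vandermonde.

(** * Linearized Reed-Solomon codes with Vandermonde local checks *)

Section LinearizedReedSolomon.
Local Open Scope ring_scope.

Variables (F : fieldType) (L : fieldExtType F) (r a : nat).
Variables (b : r.-tuple L) (pts : 'I_r -> F).
Hypothesis b_basis : basis_of fullv b.
Hypothesis pts_inj : injective pts.

(* [T] maps [x] to its syndrome under the local parity checks together with its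
   coordinates outside [S]; its kernel has codimension at most [a + #|~: S|]. *)
Lemma local_kernel_dim (S : {set 'I_r}) (phi : {linear L -> L}) (u : 'I_a -> L) :
  (forall j, j \in S -> phi b`_j = \sum_k u k * (pts j ^+ k)%:A) ->
  (#|S| - a <= \dim (lker (linfun phi)))%N.
Proof.
move=> phiE.
pose B := row_mx (vandermonde a pts)^T
  (\matrix_(j < r, l < #|~: S|) (j == enum_val l)%:R).
have T_lin : linear (fun x : L => (\row_j coord b j x) *m B).
  move=> c x y; rewrite scalemxAl -mulmxDl; congr (_ *m _).
  by apply/rowP => j; rewrite !mxE linearP.
pose T : {linear L -> 'rV[F]_(a + #|~: S|)} := HB.pack (fun x : L => (\row_j coord b j x) *m B)
  (GRing.isLinear.Build F L _ _ _ T_lin).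
have dimL : \dim {:L} = r by rewrite -(size_basis b_basis).
have sub : (lker (linfun T) <= lker (linfun phi))%VS.
  apply/subvP => x; rewrite !memv_ker !lfunE /= mul_mx_row => /eqP; rewrite -[RHS]row_mx0.
  move=> /eq_row_mx[/rowP T1 /rowP T2].
  have xS j : j \notin S -> coord b j x = 0.
    rewrite -in_setC => jS; have := T2 (enum_rank_in jS j); rewrite !mxE => <-.
    rewrite (bigD1 j) //= !mxE enum_rankK_in // eqxx mulr1 big1 ?addr0 // => k /negPf jk.
    by rewrite !mxE enum_rankK_in // jk mulr0.
  rewrite (coord_basis b_basis (memvf x)) linear_sum /=; apply/eqP.
  (* Exchanging the sums makes [phi x] a combination of the local syndromes of [x], which vanish. *)
  transitivity (\sum_k u k * (\sum_j coord b j x * pts j ^+ k)%:A); last first.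
    apply: big1 => k _; have := T1 k; rewrite !mxE => T1k.
    rewrite [X in X%:A](_ : _ = 0) ?scale0r ?mulr0 // -[RHS]T1k.
    by apply: eq_bigr => j _; rewrite !mxE.
  under [RHS]eq_bigr => k _ do rewrite scaler_suml mulr_sumr.
  rewrite exchange_big; apply: eq_bigr => j _ /=; rewrite linearZ /=.
  have [jS|/xS ->] := boolP (j \in S); last first.
    by rewrite scale0r big1 // => k _; rewrite mul0r scale0r mulr0.
  rewrite phiE // scaler_sumr; apply: eq_bigr => k _.
  by rewrite scalerAr scalerA.
apply: leq_trans (dimvS sub); have := limg_ker_dim (linfun T) fullv.
have : (\dim (linfun T @: fullv) <= a + #|~: S|)%N.
  by apply: leq_trans (dimvS (subvf _)) _; rewrite dimvf /dim /= mul1n.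
by have := cardsC S; rewrite card_ord capfv dimL; lia.
Qed.

Variables (sigma : {lrmorphism L -> L}) (g h : nat) (gam : 'I_g -> L).
Hypothesis sigma_fix : forall x, sigma x = x -> x \in 1%VS.
Hypothesis gam_neq0 : forall i, gam i != 0.
Hypothesis gam_conj : forall i j c, c != 0 -> gam i * sigma c = gam j * c -> i = j.

Definition lrs_local (i : 'I_g) : 'M[L]_(a, r) := vandermonde a (fun j => (pts j)%:A).

Definition lrs_global (i : 'I_g) : 'M[L]_(h, r) :=
  \matrix_(m, j) iter m (fun y => gam i * sigma y) b`_j.

(** Used twice: the full set gives independence of the rows, and [#|S| = g * a + h] gives an
    invertible square submatrix. *)
Lemma lrs_rows_indep (S : {set 'I_g * 'I_r}) (u : ('I_g * 'I_a) + 'I_h -> L) :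
    (g * a + h <= #|S|)%N ->
    (forall i, (a <= #|[set c in S | c.1 == i]|)%N) ->
    (forall c, c \in S -> \sum_row u row * pcm lrs_local lrs_global row c = 0) ->
  forall row, u row = 0.
Proof.
move=> S_large S_i u_ker.
(* The coefficients of the global rows, extended by zero beyond [h]. *)
pose f k := if insub k is Some m then u (inr m) else 0.
have local_eq i j : (i, j) \in S ->
    \sum_k u (inl (i, k)) * (pts j ^+ k)%:A + skew_eval sigma h f (gam i) b`_j = 0.
  move=> /u_ker u_ij; rewrite -[RHS]u_ij big_sumType /=; congr (_ + _).
    pose G i0 k := u (inl (i0, k)) * if i0 == i then lrs_local i0 k j else 0.
    rewrite (eq_bigr (fun p => G p.1 p.2)); last by case.
    rewrite -(pair_bigA _ G) /G /=.
    rewrite (bigD1 i) //= [X in _ + X]big1 ?addr0 => [|i' /negPf i'i].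
      by apply: eq_bigr => k _; rewrite eqxx mxE -in_algE rmorphXn.
    by apply: big1 => k _; rewrite i'i mulr0.
  by rewrite /skew_eval; apply: eq_bigr => m _; rewrite /f valK mxE.
pose S' i := [set j | (i, j) \in S].
have cardS' i : #|S' i| = #|[set c in S | c.1 == i]|.
  have pair_inj : injective (pair i : 'I_r -> 'I_g * 'I_r) by move=> j j' [].
  rewrite -(card_imset _ pair_inj); apply: eq_card => -[i' j]; rewrite !inE /=.
  apply/imsetP/andP => [[j' + [-> ->]]|[ijS /eqP ii']]; first by rewrite inE.
  by exists j; rewrite ?inE -ii'.
have sumS' : (\sum_i #|S' i| = #|S|)%N.
  rewrite -sum1_card (partition_big fst xpredT) //=; apply: eq_bigr => i _.
  by rewrite cardS' -sum1_card; apply: eq_bigl => c; rewrite inE.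
have u_global m : u (inr m) = 0.
  apply/eqP; apply: contraT => um.
  have fm : f m != 0 by rewrite /f valK.
  have := skew_eval_dim_ker sigma_fix gam_neq0 gam_conj (ltn_ord m) fm.
  suff : (h <= \sum_i \dim (lker (linfun (skew_eval sigma h f (gam i)))))%N by lia.
  (* No subtraction truncates here, since every [S' i] has at least [a] elements. *)
  apply: leq_trans (_ : \sum_i (#|S' i| - a) <= _)%N.
    rewrite -(leq_add2l (g * a)); apply: leq_trans S_large _; rewrite -sumS'.
    rewrite -[g in (g * a)%N]card_ord -sum_nat_const -big_split leq_sum // => i _ /=.
    by rewrite subnKC // cardS'.
  apply: leq_sum => i _; apply: (local_kernel_dim (u := fun k => - u (inl (i, k)))) => j.
  rewrite inE => /local_eq/eqP; rewrite addrC addr_eq0 => /eqP /= ->.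
  by rewrite -sumrN; apply: eq_bigr => k _; rewrite mulNr.
case=> [[i k]|//].
(* With the global coefficients gone, a nonzero [w] would be a polynomial of degree less than a with
   at least a roots. *)
pose w := \row_k u (inl (i, k)).
suff w0 : w = 0 by have := congr1 (fun v : 'rV_a => v 0 k) w0; rewrite !mxE.
apply/eqP; apply: contraT => w_neq0.
have ptsL_inj : injective (fun j => (pts j)%:A : L).
  by move=> j j' /(fmorph_inj (in_alg L)) /pts_inj.
have := vandermonde_zeros ptsL_inj w_neq0; rewrite ltnNge => /negP[].
apply: leq_trans (S_i i) _; rewrite -cardS'; apply: subset_leq_card.
apply/subsetP => j; rewrite !inE => /local_eq.
rewrite [skew_eval _ _ _ _ _]big1 ?addr0 => [eq0|k' _]; last first.
  by rewrite /f valK u_global mul0r.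
rewrite mxE -[X in _ == X]eq0; apply/eqP; apply: eq_bigr => k' _.
by rewrite !mxE -!in_algE rmorphXn.
Qed.

Lemma lrs_MR : (0 < a)%N -> (a <= r)%N -> (g * a + h <= g * r)%N ->
  is_MR_LRC lrs_local lrs_global.
Proof.
move=> a_gt0 lear le_n; split.
- move=> i; apply: vandermonde_MDS => // j j'.
  by move=> /(fmorph_inj (in_alg L)) /pts_inj.
- move=> u u_ker; apply: (@lrs_rows_indep setT) => // [|i].
    by rewrite cardsT card_prod !card_ord.
  apply: leq_trans lear _.
  have pair_inj : injective (pair i : 'I_r -> 'I_g * 'I_r) by move=> j j' [].
  rewrite -[leqLHS]card_ord -cardsT -(card_imset _ pair_inj); apply: subset_leq_card.
  by apply/subsetP => _ /imsetP[j _ ->]; rewrite !inE /=.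
move=> S cardS S_i v v_out v_ker.
(* The submatrix on [S] is square, so independence of its rows passes to its columns. *)
pose H := pcm lrs_local lrs_global.
pose M : 'M[L]_(#|{: ('I_g * 'I_a) + 'I_h}|, #|S|) :=
  \matrix_(x, y) H (enum_val x) (enum_val y).
have M_free : row_free M.
  apply: inj_row_free => w wM0.
  have u0 := lrs_rows_indep (u := fun row => w 0 (enum_rank row)) (eq_leq (esym cardS)) S_i.
  apply/rowP => x; rewrite mxE -[x]enum_valK; apply: u0 => c cS.
  move/rowP: wM0 => /(_ (enum_rank_in cS c)); rewrite !mxE => w_c.
  rewrite -[RHS]w_c [RHS](reindex enum_rank) /=; last exact/onW_bij/enum_rank_bij.
  by apply: eq_bigr => row _; rewrite !mxE enum_rankK enum_rankK_in.
have Mt_free : row_free M^T.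
  by rewrite /row_free mxrank_tr (eqP M_free) card_sum card_prod !card_ord cardS.
pose w := \row_y v (enum_val y : 'I_g * 'I_r) : 'rV_#|S|.
have : w *m M^T == 0.
  apply/eqP/rowP => x; rewrite !mxE -[RHS](v_ker (enum_val x)).
  rewrite [RHS](bigID (mem S)) /= [X in _ + X]big1 ?addr0; last first.
    by move=> c cS; rewrite v_out ?mulr0.
  rewrite [RHS]big_enum_val; apply: eq_bigr => y _.
  by rewrite !mxE mulrC.
rewrite mulmx_free_eq0 // => /eqP/rowP w0 c.
have [cS|/v_out //] := boolP (c \in S).
by have := w0 (enum_rank_in cS c); rewrite !mxE enum_rankK_in.
Qed.
End LinearizedReedSolomon.

(** * Frobenius and non-conjugate multipliers over a finite field *)

Section FiniteField.
Local Open Scope ring_scope.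

Lemma natr_Fp_inj (p r : nat) :
  prime p -> (r <= p)%N -> injective (fun j : 'I_r => (j%:R : 'F_p)).
Proof.
move=> p_pr lerp j j' /(congr1 val); rewrite /= !val_Fp_nat // !modn_small.
- exact: val_inj.
- exact: leq_trans lerp.
exact: leq_trans lerp.
Qed.

Lemma finField_prim_root (K : finFieldType) : exists z : K, #|K|.-1.-primitive_root z.
Proof.
have /hasP[z _ z_prim] : has #|K|.-1.-primitive_root (enum [pred x : K | x != 0]).
  apply: has_prim_root; rewrite ?enum_uniq -?cardE //.
  - by rewrite -ltnS prednK ?finNzRing_gt1 // ltnW ?finNzRing_gt1.
  - apply/allP => x; rewrite mem_enum inE => x_neq0.
    rewrite unity_rootE; apply/eqP/(mulIf x_neq0).
    by rewrite mul1r -exprSr prednK ?expf_card // ltnW ?finNzRing_gt1.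
  by rewrite cardC1.
by exists z.
Qed.

(** Raising to the power M = (#|K| - 1) / (p - 1) is the norm to the prime field: it sends c^(p-1)
    to 1 and separates the z^i with i < p - 1. *)
Lemma prim_root_conj (K : finFieldType) (p r : nat) (z c : K) (i j : nat) :
    prime p -> (0 < r)%N -> #|K| = (p ^ r)%N -> #|K|.-1.-primitive_root z -> c != 0 ->
    (i < p.-1)%N -> (j < p.-1)%N -> z ^+ i * c ^+ p = z ^+ j * c -> i = j.
Proof.
move=> p_pr r_gt0 cardK z_prim c_neq0 lti ltj.
have p_gt0 := prime_gt0 p_pr.
have /dvdnP[M QE] : (p.-1 %| #|K|.-1)%N by rewrite cardK dvdn_pred_predX.
have Q_gt0 : (0 < #|K|.-1)%N by rewrite -ltnS prednK ?finNzRing_gt1 // ltnW ?finNzRing_gt1.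
have M_gt0 : (0 < M)%N by move: Q_gt0; rewrite QE muln_gt0 => /andP[].
rewrite -[in c ^+ p](prednK p_gt0) exprSr mulrA => /(mulIf c_neq0).
move/(congr1 (fun x => x ^+ M)); rewrite exprMn -!exprM [(p.-1 * _)%N]mulnC -QE.
have -> : c ^+ #|K|.-1 = 1.
  apply: (mulIf c_neq0).
  by rewrite mul1r -exprSr prednK ?expf_card // ltnW ?finNzRing_gt1.
rewrite mulr1 => /eqP; rewrite (eq_prim_root_expr z_prim) !modn_small; last 2 first.
- by rewrite QE mulnC ltn_pmul2l.
- by rewrite QE mulnC ltn_pmul2l.
by rewrite eqn_pmul2r // => /eqP.
Qed.

Lemma exists_MR_lrs (p g r h a : nat) :
    prime p -> (r <= p)%N -> (g < p)%N -> (0 < a)%N -> (a <= r)%N ->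
    (g * a + h <= g * r)%N ->
  exists K : finFieldType, #|K| = (p ^ r)%N /\
    exists (A : 'I_g -> 'M[K]_(a, r)) (D : 'I_g -> 'M[K]_(h, r)), is_MR_LRC A D.
Proof.
move=> p_pr lerp ltgp a_gt0 lear le_n; have r_gt0 : (0 < r)%N by apply: leq_trans lear.
have [K charK cardK] := pPrimePowerField p_pr r_gt0.
exists K; split=> //.
pose L : fieldExtType 'F_p := pPrimeCharType charK.
have dimL : \dim {:L} = r by rewrite pprimeChar_dimf cardK pfactorK.
have charL : p \in [pchar L] by [].
have Frob_scalable : scalable (pFrobenius_aut charL).
  move=> k x; have := expf_card k; rewrite card_Fp // => kp.
  by rewrite pFrobenius_autE exprZn kp.
pose frob : {rmorphism L -> L} := pFrobenius_aut charL.
pose sigma : {lrmorphism L -> L} := HB.pack (pFrobenius_aut charL) frob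
  (GRing.isScalable.Build _ _ _ _ _ Frob_scalable).
have sigma_fix (x : L) : sigma x = x -> x \in 1%VS.
  move=> /= xE; rewrite (Fermat's_little_theorem 1%AS) dimv1 expn1 card_Fp //.
  exact/eqP.
have [z z_prim] := finField_prim_root K.
have [b b_basis] : exists b : r.-tuple L, basis_of fullv b.
  by rewrite -dimL; exists (vbasis _); apply: vbasisP.
have z_neq0 (i : 'I_g) : (z ^+ i : L) != 0.
  by rewrite expf_eq0 negb_and (prim_root_eq0 z_prim) -lt0n (prim_order_gt0 z_prim) orbT.
have z_conj (i j : 'I_g) (c : L) :
    c != 0 -> (z ^+ i : L) * sigma c = (z ^+ j : L) * c -> i = j.
  move=> c_neq0 eq_ij; apply/val_inj.
  by apply: (prim_root_conj p_pr r_gt0 cardK z_prim c_neq0 _ _ eq_ij);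
    [have := ltn_ord i | have := ltn_ord j]; lia.
(* The local points are 0, ..., r - 1 in ['F_p], and the multipliers are z^i with i < g <= p - 1. *)
have MR := lrs_MR (h := h) b_basis (natr_Fp_inj p_pr lerp) sigma_fix z_neq0 z_conj
  a_gt0 lear le_n.
do 2!eexists; exact: MR.
Qed.
End FiniteField.

(** * Real estimates relating [n], [r] and [h] *)

Section Asymptotics.
Local Open Scope R_scope.

Lemma INR_expn (m k : nat) : INR (m ^ k)%N = INR m ^ k.
Proof. by elim: k => [|k IHk]; rewrite ?expnS ?mult_INR ?IHk. Qed.

(** As eps < 1/2, h r >= n^(1 - eps) >= sqrt n >= r^2 / eps; divide by r. *)
Lemma le_eps_mul_of_large (n r h : nat) (eps : R) :
    0 < eps -> eps < 1 / 2 -> 1 <= INR r -> (INR r ^ 2 / eps) ^ 2 <= INR n ->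
    Rpower (INR n) (1 - eps) <= INR h * INR r ->
  INR r <= eps * INR h.
Proof.
move=> eps_gt0 eps_lt r_ge1 n_large h_large.
have t_ge1 : 1 <= INR r ^ 2 / eps.
  apply: (Rmult_le_reg_r eps) => //; rewrite Rmult_1_l /Rdiv Rmult_assoc Rinv_l; nra.
have n_ge1 : 1 <= INR n by nra.
have : INR r ^ 2 / eps <= INR h * INR r.
  apply: Rle_trans h_large; apply: Rle_trans (_ : sqrt (INR n) <= _).
    by rewrite -(sqrt_pow2 (INR r ^ 2 / eps)); [apply: sqrt_le_1; nra | lra].
  by rewrite -Rpower_sqrt; [apply: Rle_Rpower; lra | lra].
move=> le_hr; apply: (Rmult_le_reg_l (INR r)); first lra.
have : INR r ^ 2 / eps * eps <= INR h * INR r * eps by apply: Rmult_le_compat_r; lra.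
rewrite /Rdiv Rmult_assoc Rinv_l; nra.
Qed.

Lemma nat_above (x : R) : exists m : nat, x <= INR m.
Proof. by have [m mx] := INR_unbounded x; exists m; lra. Qed.

End Asymptotics.

(** * Choice of the prime and comparison of p^r with the bound *)

Theorem theorem4p4 :
  exists c1 c2 : R, Rlt 0 c1 /\ Rlt 0 c2 /\
  forall (a r : nat), (0 < a)%N -> (a <= r)%N ->
  forall eps : R, Rlt 0 eps -> Rlt eps (Rdiv 1 2) ->
  forall N : nat, exists n : nat,
    (N <= n)%N /\ (r %| n)%N /\
    Rle (Rpower (INR r) (Rdiv (Rmult c1 (INR r)) eps)) (INR n) /\
    forall h : nat, (0 < h)%N ->
      Rle (Rmult c2 (Rpower (INR n) (Rminus 1 eps))) (Rmult (INR h) (INR r)) ->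
      ((n %/ r) * a + h < n)%N ->
      exists_MR_LRC n r h a (Rpower (INR n) (Rmult eps (INR h))).
Proof.
exists R1, R1; split; [exact: Rlt_0_1 | split; [exact: Rlt_0_1|]].
move=> a r a_gt0 lear eps eps_gt0 eps_lt N.
have r_gt0 : (0 < r)%N by apply: leq_trans lear.
have [m1 le_m1] := nat_above (Rpower (INR r) (Rdiv (Rmult R1 (INR r)) eps)).
have [m2 le_m2] := nat_above (pow (Rdiv (pow (INR r) 2) eps) 2).
(* [N] and [m1] give the lower bounds on [n], [r] gives enough points in ['F_p], and [m2] serves
   [le_eps_mul_of_large]. *)
have [p p_gt p_pr] := prime_above (N + r + m1 + m2).
have p_gt1 := prime_gt1 p_pr.
pose n := (r * p.-1)%N.
have le_n : (p.-1 <= n)%N by rewrite leq_pmull.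
have INR_le k : (k <= n)%N -> Rle (INR k) (INR n) by move=> /leP; apply: le_INR.
exists n; split; first by lia.
split; first exact: dvdn_mulr.
split; first by apply: Rle_trans le_m1 (INR_le _ _); lia.
rewrite /exists_MR_LRC mulKn // => h h_gt0; rewrite Rmult_1_l => h_large lt_n.
(* The length condition forces a < r. From r >= 2 follows p <= 2 (p - 1) <= n, hence p^r <= n^r. *)
have r_gt1 : (1 < r)%N.
  have : (p.-1 * a < p.-1 * r)%N.
    by rewrite [X in (_ < X)%N]mulnC; apply: leq_ltn_trans lt_n; apply: leq_addr.
  by rewrite ltn_mul2l => /andP[_]; apply: leq_trans.
have [||||||K [cardK MR]] := @exists_MR_lrs p p.-1 r h a => //; try by lia.
exists K; split=> //; rewrite cardK INR_expn.
have le_pn : (p <= n)%N.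
  by apply: leq_trans (leq_mul r_gt1 (leqnn p.-1)); lia.
have n_gt0 : Rlt 0 (INR n) by apply/lt_0_INR/leP; lia.
apply: Rle_trans (_ : Rle (pow (INR n) r) _).
  by apply: pow_incr; split; [apply: pos_INR | apply: INR_le].
rewrite -Rpower_pow //; apply: Rle_Rpower.
  by apply: (le_INR 1); apply/leP; lia.
apply: le_eps_mul_of_large h_large => //.
  by apply: (le_INR 1); apply/leP.
by apply: Rle_trans le_m2 (INR_le _ _); lia.
Qed.
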